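(* Let $\Omega$ be a finite basis for a category $\mathbf{J}$ and let $D\colon\mathbf{J}\to\mathbf{C}$ be a functor into a dagger category $\mathbf{C}$ enriched in commutative monoids. A limit $(L,(l_A\colon L\to D(A))_{A\in\mathbf{J}})$ of $D$ is a dagger limit of $(D,\Omega)$ if and only if $\mathrm{id}_L=\sum_{A\in\Omega} l_A^\dagger l_A$.
   Context: A dagger category is a category $\mathbf{C}$ equipped with an identity-on-objects functor $\dagger\colon\mathbf{C}^{\mathrm{op}}\to\mathbf{C}$ satisfying $f^{\dagger\dagger}=f$. A morphism $f$ is a partial isometry if $f=ff^\dagger f$. Enriched in commutative monoids means that each hom-set is a commutative monoid $(+,0)$ and composition is bilinear (in particular composing with $0$ gives $0$). A class $\Omega$ of objects of $\mathbf{J}$ is a basis if for every object $B$ of $\mathbf{J}$ there is a unique $A\in\Omega$ with $\mathbf{J}(A,B)\neq\emptyset$. A dagger limit of $(D,\Omega)$ is a limit $(L,l_A\colon L\to D(A))$ of $D$ such that $l_A$ is a partial isometry for all $A\in\Omega$ and $l_A^\dagger l_A l_B^\dagger l_B=l_B^\dagger l_B l_A^\dagger l_A$ for all $A,B\in\Omega$. *)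

(* Defs.v *)
From HB Require Import structures.
From mathcomp Require Import all_boot ssralg.
From mathcomp Require Import boolp classical_sets cardinality fsbigop.

Set Implicit Arguments.
Unset Strict Implicit.
Unset Printing Implicit Defensive.

Local Open Scope ring_scope.

Reserved Notation "g \oc f" (at level 50, format "g  \oc  f", left associativity).

HB.mixin Record isCategory (obj : Type) := {
  hom : obj -> obj -> Type;
  idm : forall A, hom A A;
  mcomp : forall A B C, hom B C -> hom A B -> hom A C;
  mcomp_idl : forall A B (f : hom A B), @mcomp A B B (@idm B) f = f;
  mcomp_idr : forall A B (f : hom A B), @mcomp A A B f (@idm A) = f;
  mcompA : forall A B C D (h : hom C D) (g : hom B C) (f : hom A B),
    @mcomp A C D h (@mcomp A B C g f) = @mcomp A B D (@mcomp B C D h g) f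
}.

#[short(type="category")]
HB.structure Definition Category := {obj of isCategory obj}.

Arguments idm {s} A.
Arguments mcomp {s A B C} _ _.
Arguments mcomp_idl {s A B} f.
Arguments mcomp_idr {s A B} f.
Arguments mcompA {s A B C D} h g f.
Notation "g \oc f" := (mcomp g f).

HB.mixin Record isDagger obj of Category obj := {
  dagger : forall A B : obj, hom A B -> hom B A;
  dagger_id : forall A : obj, @dagger A A (idm A) = idm A;
  dagger_comp : forall (A B C : obj) (g : hom B C) (f : hom A B),
    @dagger A C (g \oc f) = @dagger A B f \oc @dagger B C g;
  daggerK : forall (A B : obj) (f : hom A B), @dagger B A (@dagger A B f) = f
}.

#[short(type="daggerCategory")]
HB.structure Definition DaggerCategory := {obj of isDagger obj & Category obj}.

Arguments dagger {s A B} _.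
Arguments dagger_id {s} A.
Arguments dagger_comp {s A B C} g f.
Arguments daggerK {s A B} f.

HB.mixin Record isCMonEnriched obj of Category obj := {
  hzero : forall A B : obj, hom A B;
  hadd : forall A B : obj, hom A B -> hom A B -> hom A B;
  haddA : forall A B : obj, associative (@hadd A B);
  haddC : forall A B : obj, commutative (@hadd A B);
  hadd0 : forall A B : obj, left_id (@hzero A B) (@hadd A B);
  mcomp_addl : forall (A B C : obj) (g1 g2 : hom B C) (f : hom A B),
    @hadd B C g1 g2 \oc f = @hadd A C (g1 \oc f) (g2 \oc f);
  mcomp_addr : forall (A B C : obj) (g : hom B C) (f1 f2 : hom A B),
    g \oc @hadd A B f1 f2 = @hadd A C (g \oc f1) (g \oc f2);
  mcomp_zerol : forall (A B C : obj) (f : hom A B),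
    @hzero B C \oc f = @hzero A C;
  mcomp_zeror : forall (A B C : obj) (g : hom B C),
    g \oc @hzero A B = @hzero A C
}.

#[short(type="cmonCategory")]
HB.structure Definition CMonCategory :=
  {obj of isCMonEnriched obj & Category obj}.

Arguments hzero {s} A B.
Arguments hadd {s A B} _ _.
Arguments haddA {s A B} x y z.
Arguments haddC {s A B} x y.
Arguments hadd0 {s A B} x.
Arguments mcomp_addl {s A B C} g1 g2 f.
Arguments mcomp_addr {s A B C} g f1 f2.
Arguments mcomp_zerol {s A B} C f.
Arguments mcomp_zeror {s} A {B C} g.

(* No compatibility between the dagger and the addition is assumed. *)
#[short(type="cmonDaggerCategory")]
HB.structure Definition CMonDaggerCategory :=
  {obj of isDagger obj & isCMonEnriched obj & Category obj}.

(* [nmodType] requires decidable equality and choice on the carrier; both are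
   supplied classically, so that [hom A B] may be an arbitrary monoid. *)
Section HomNmodule.
Variables (C : cmonCategory) (A B : C).
HB.instance Definition _ := gen_eqMixin (hom A B).
HB.instance Definition _ := gen_choiceMixin (hom A B).
HB.instance Definition _ := GRing.isNmodule.Build (hom A B)
  (@haddA C A B) (@haddC C A B) (@hadd0 C A B).
End HomNmodule.

Record functor (J C : category) := Functor {
  fobj :> J -> C;
  fmap : forall A B : J, hom A B -> hom (fobj A) (fobj B);
  fmap_id : forall A : J, @fmap A A (idm A) = idm (fobj A);
  fmap_comp : forall (X Y Z : J) (g : hom Y Z) (f : hom X Y),
    @fmap X Z (g \oc f) = @fmap Y Z g \oc @fmap X Y f
}.

Arguments fmap {J C} _ [A B] _.

Definition is_cone (J C : category) (D : functor J C) (X : C)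
    (x : forall A : J, hom X (D A)) : Prop :=
  forall (A B : J) (f : hom A B), fmap D f \oc x A = x B.

Arguments is_cone {J C} D {X} x.

Definition is_limit (J C : category) (D : functor J C) (L : C)
    (l : forall A : J, hom L (D A)) : Prop :=
  is_cone D l /\
  forall (X : C) (x : forall A : J, hom X (D A)), is_cone D x ->
    exists! u : hom X L, forall A : J, l A \oc u = x A.

Arguments is_limit {J C} D {L} l.

Definition is_basis (J : category) (Omega : set J) : Prop :=
  forall B : J, exists! A : J, Omega A /\ inhabited (hom A B).

Definition partial_isometry (C : daggerCategory) (A B : C) (f : hom A B) : Prop :=
  f = f \oc dagger f \oc f.

Definition is_dagger_limit (J : category) (C : daggerCategory)
    (D : functor J C) (Omega : set J) (L : C)
    (l : forall A : J, hom L (D A)) : Prop :=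
  [/\ is_limit D l,
      forall A : J, Omega A -> partial_isometry (l A) &
      forall A B : J, Omega A -> Omega B ->
        dagger (l A) \oc l A \oc (dagger (l B) \oc l B) =
        dagger (l B) \oc l B \oc (dagger (l A) \oc l A)].

Arguments is_dagger_limit {J C} D Omega {L} l.

(* Main.v *)
Require Import Defs.
From mathcomp Require Import all_boot ssralg.
From mathcomp Require Import boolp classical_sets cardinality fsbigop.

(** Write [p A := dagger (l A) \oc l A].  Both conditions say that the [p A],
    for [A] in the basis, are the orthogonal projections of [L] onto its
    components, and the universal property of the limit supplies a second
    description of these projections.

    The objects of [J] are partitioned according to the basis object that maps
    to them, and this partition is respected by the morphisms of [J].  So, for
    [A] in the basis, keeping the legs [l B] with [B] in the class of [A] and
    replacing the others by [0] gives another cone on [L].  The induced [u]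
    satisfies [l A \oc u = l A] and [l B \oc u = 0] for the other [B] in the
    basis ([limit_component]).

    If the [p A] sum to the identity, then [u] is the sum of the [p B \oc u],
    in which only [p A] survives.  Hence [p A = u], so [l A \oc p A = l A], the
    partial isometry condition, and [l B \oc p A = 0] if [B] is another basis
    object.  Then [p A] and [p B] have zero product in either order, and in
    particular commute.

    If conversely [l] is a dagger limit, commutation moves [p B] next to [u]:
    [p B \oc p A = p B \oc p A \oc u = p A \oc p B \oc u = 0].  As [l B] is a
    partial isometry, [l B \oc p A = 0] ([dagger_limit_orthogonal]), so the sum
    of the [p A] is not distinguished from the identity by the [l B] with [B]
    in the basis.  Such legs are jointly monic ([limit_hom_ext]). *)

Local Open Scope ring_scope.

Section Sums.
Context (C : cmonCategory) (I : choiceType).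
Implicit Types (S : set I).

Lemma mcomp_fsumr {X Y Z : C} (g : hom Y Z) S (F : I -> hom X Y) :
  finite_set S -> g \oc \sum_(i \in S) F i = \sum_(i \in S) (g \oc F i).
Proof.
move=> finS; rewrite !fsbig_finite //=.
exact: (big_morph _ (mcomp_addr g) (mcomp_zeror _ g)).
Qed.

Lemma mcomp_fsuml {X Y Z : C} (f : hom X Y) S (F : I -> hom Y Z) :
  finite_set S -> (\sum_(i \in S) F i) \oc f = \sum_(i \in S) (F i \oc f).
Proof.
move=> finS; rewrite !fsbig_finite //=.
exact: (big_morph (fun h => h \oc f) (fun g h => mcomp_addl g h f)
  (mcomp_zerol _ f)).
Qed.

End Sums.

Lemma fsum_single {I : choiceType} {V : nmodType} (S : set I) (F : I -> V) i :
  S i -> (forall j, S j -> j <> i -> F j = 0) -> \sum_(j \in S) F j = F i.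
Proof.
move=> Si F0; have <- : \sum_(j \in [set i]) F j = F i by rewrite fsbig_set1.
apply/esym/fsbig_widen.
  by move=> j ->.
by move=> j [Sj ji]; exact: F0.
Qed.

(** The class of [A] is closed under morphisms in both directions.  Backwards
    this uses uniqueness: the basis object of [B] also maps to [B'], so it can
    only be [A]. *)
Lemma basis_hom {J : category} {Omega : set J} {A B B' : J} :
  is_basis Omega -> Omega A -> hom B B' ->
  inhabited (hom A B) <-> inhabited (hom A B').
Proof.
move=> basisOmega OA f; split=> [[g]|hB']; first exact: inhabits (f \oc g).
have [A0 [[OA0 [g]] _]] := basisOmega B.
have [A1 [_ uniq]] := basisOmega B'.
have <- : A0 = A.
  rewrite -(uniq A) // -(uniq A0) //.
  by split=> //; exact: inhabits (f \oc g).
exact: inhabits g.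
Qed.

Section LimitOverBasis.
Context {J : category} {C : cmonDaggerCategory} {D : functor J C}.
Context {Omega : set J} (basisOmega : is_basis Omega).
Context {L : C} {l : forall A : J, hom L (D A)} (limL : is_limit D l).

Local Notation p A := (dagger (l A) \oc l A).

Lemma basis_eq_hom {A B : J} : Omega A -> Omega B -> hom A B -> A = B.
Proof.
move=> OA OB f; have [A0 [_ uniq]] := basisOmega B.
rewrite -(uniq A); last by split=> //; exact: inhabits f.
by apply: uniq; split=> //; exact: inhabits (idm B).
Qed.

(** This needs no dagger: by [basis_hom], zeroing the legs at the objects that
    [A] does not reach leaves a cone, and [u] is the map that it induces. *)
Lemma limit_component {A : J} : Omega A ->
  exists u : hom L L, l A \oc u = l A /\
    forall B, Omega B -> B <> A -> l B \oc u = 0.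
Proof.
move=> OA; have [coneL univL] := limL.
pose x B : hom L (D B) := if pselect (inhabited (hom A B)) then l B else 0.
have /univL [u [lu _]] : is_cone D x.
  move=> B B' f; rewrite /x; have hBB' := basis_hom basisOmega OA f.
  case: pselect => hB; case: pselect => hB'.
  - exact: coneL.
  - by case: hB'; apply/hBB'.
  - by case: hB; apply/hBB'.
  - exact: mcomp_zeror.
exists u; split=> [|B OB BA]; rewrite lu /x; case: pselect => //.
- by case; exact: inhabits (idm A).
- by case=> f; case: BA; rewrite (basis_eq_hom OA OB f).
Qed.

(** Every leg factors through a basis leg, so the basis legs inherit the joint
    monicity of all legs of a limit. *)
Lemma limit_hom_ext {X : C} (f g : hom X L) :
  (forall A, Omega A -> l A \oc f = l A \oc g) -> f = g.
Proof.
have [coneL univL] := limL => fg.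
have /univL [u [_ uniq]] : is_cone D (fun B => l B \oc f).
  by move=> B B' h; rewrite mcompA coneL.
rewrite -(uniq f) // -(uniq g) // => B.
have [A [[OA [h]] _]] := basisOmega B.
by rewrite -(coneL _ _ h) -!mcompA fg.
Qed.

(** Commutation of the projections transfers this vanishing to [p A] from the
    [u] of [limit_component], for which it holds by construction. *)
Lemma dagger_limit_orthogonal {A B : J} :
  is_dagger_limit D Omega l -> Omega A -> Omega B -> B <> A ->
  l B \oc p A = 0.
Proof.
move=> [_ piso comm] OA OB BA; have [u [lAu lBu]] := limit_component OA.
have pBA : p B \oc p A = 0.
  have -> : p A = p A \oc u by rewrite -mcompA lAu.
  rewrite mcompA comm // -mcompA -(mcompA (dagger (l B))) lBu //.
  by rewrite !mcomp_zeror.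
by rewrite (piso B OB) -(mcompA (l B)) -mcompA pBA mcomp_zeror.
Qed.

End LimitOverBasis.

Theorem proposition5p13 (J : category) (C : cmonDaggerCategory)
    (D : functor J C) (Omega : set J)
    (finOmega : finite_set Omega) (basisOmega : is_basis Omega)
    (L : C) (l : forall A : J, hom L (D A)) (limL : is_limit D l) :
  is_dagger_limit D Omega l <->
  idm L = \sum_(A \in (Omega : set {classic J})) (dagger (l A) \oc l A).
Proof.
split=> [dlim|idE].
  apply: (limit_hom_ext basisOmega limL) => B OB.
  rewrite mcomp_idr mcomp_fsumr // (@fsum_single {classic J} _ _ _ B) //.
    by rewrite mcompA; case: dlim => _ piso _; exact: piso.
  move=> A OA AB; apply: (dagger_limit_orthogonal basisOmega limL) => //.
  by move/esym.
(* [p A] is the projection [u] that the universal property provides. *)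
have projE A : Omega A -> l A \oc (dagger (l A) \oc l A) = l A /\
    forall B, Omega B -> B <> A -> l B \oc (dagger (l A) \oc l A) = 0.
  move=> OA; have [u [lAu lBu]] := limit_component basisOmega limL OA.
  suff <- : u = dagger (l A) \oc l A by [].
  rewrite -[LHS]mcomp_idl idE mcomp_fsuml //.
  rewrite (@fsum_single {classic J} _ _ _ A) //; first by rewrite -mcompA lAu.
  by move=> B OB BA; rewrite -mcompA lBu // mcomp_zeror.
split=> // [A OA|A B OA OB].
  by rewrite /partial_isometry -mcompA (projE A OA).1.
have [->//|AB] := pselect (A = B).
rewrite -!(mcompA (dagger _)) (projE B OB).2 // (projE A OA).2 //; last by move/esym.
by rewrite !mcomp_zeror.
Qed.
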